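(* Let $H$ be a $k$-uniform hypergraph with $n$ vertices and multiple distinct edges. Let $m\in\{1,2,\ldots,k-1\}$, $p_1=\frac{m}{k}$, and $p_2\in\left(\frac{m}{k},\frac{m+1}{k}\right)$. Then $b_{L,p_1}(H)<b_{L,p_2}(H)$ and $b_{p_1}(H)<b_{p_2}(H)$.
   Context: A hypergraph $H=(V(H),E(H))$ has a finite nonempty vertex set and a finite collection $E(H)$ of subsets of $V(H)$ called edges; it is $k$-uniform if every edge has exactly $k$ vertices. For a proportion $p\in(0,1)$, the proportion-based propagation rule is: if at the end of a round at least $\lceil p|e|\rceil$ vertices of an edge $e$ are on fire, then in the next round all vertices of $e$ catch fire; burned vertices stay burned. Burning game: let $F_0=\emptyset$ and $F_r$ be the set of burned vertices at the end of round $r$. In each round $r\geq 1$, simultaneously, vertices catch fire by propagation from $F_{r-1}$ (no propagation in round 1), and a player chooses a vertex $u_r\notin F_{r-1}$ (a source) and sets it on fire. A burning sequence is a sequence $(u_1,\ldots,u_k)$ of such sources after which every vertex is on fire at the end of round $k$; $b_p(H)$ is the minimum length of a burning sequence. Lazy game: $S\subseteq V(H)$ is a lazy burning set if, setting all of $S$ on fire at once and then repeatedly applying the propagation rule, every vertex eventually catches fire; $b_{L,p}(H)$ is the minimum size of a lazy burning set. *)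

(* Defs.v *)
From mathcomp Require Import all_boot all_order all_algebra.
From mathcomp Require Import boolp reals.

Set Implicit Arguments.
Unset Strict Implicit.
Unset Printing Implicit Defensive.

Import Order.TTheory GRing.Theory Num.Theory.
Local Open Scope ring_scope.

Record hypergraph := Hypergraph {
  vertex :> finType;
  edges : {set {set vertex}};
  vertex_gt0 : (0 < #|vertex|)%N
}.

Definition uniform (k : nat) (H : hypergraph) : Prop :=
  forall e : {set H}, e \in edges H -> #|e| = k.

Definition ignites (R : realType) (p : R) (H : hypergraph) (F e : {set H}) :
    bool :=
  Num.ceil (p * #|e|%:R) <= #|e :&: F|%:Z.

Definition propagate (R : realType) (p : R) (H : hypergraph) (F : {set H}) :
    {set H} :=
  F :|: \bigcup_(e in edges H | ignites p F e) e.

(* [fire p us r] is F_r when the sources are u_1, u_2, ... = us; thus u_r.+1 is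
   item r of us. No special case is needed for round 1: for p > 0 no nonempty
   edge ignites from set0, see [propagate0]. *)
Definition fire (R : realType) (p : R) (H : hypergraph) (us : seq H) (r : nat) :
    {set H} :=
  foldl (fun F u => u |: propagate p F) set0 (take r us).

Definition burning_sequence (R : realType) (p : R) (H : hypergraph)
    (us : seq H) : Prop :=
  (forall (r : nat) (u : H), onth us r = Some u -> u \notin fire p us r) /\
  fire p us (size us) = [set: H].

Definition lazy_burning_set (R : realType) (p : R) (H : hypergraph)
    (S : {set H}) : Prop :=
  forall v : H, exists r : nat, v \in iter r (@propagate R p H) S.

Lemma propagate0 (R : realType) (p : R) (H : hypergraph) :
  0 < p -> propagate p (set0 : {set H}) = set0.
Proof.
move=> p0; rewrite /propagate set0U; apply: big1 => e /andP[_].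
rewrite /ignites setI0 cards0 => ce.
apply/eqP; rewrite -cards_eq0 eqn0Ngt; apply/negP => e0.
have : p * #|e|%:R <= 0 by rewrite -(@ceil_le_int R _ 0).
by rewrite leNgt mulr_gt0 // ltr0n.
Qed.

Lemma exists_burning_sequence (R : realType) (p : R) (H : hypergraph) :
  exists k : nat,
    `[< exists us : seq H, size us = k /\ burning_sequence p us >].
Proof.
suff ext c (us : seq H) :
    (#|~: fire p us (size us)| <= c)%N ->
    (forall r u, onth us r = Some u -> u \notin fire p us r) ->
    exists vs : seq H, burning_sequence p vs.
  have [|us bus] := @ext #|H| [::] (max_card _); first by case.
  by exists (size us); apply/asboolP; exists us.
elim: c us => [|c IH] us.
  rewrite leqn0 cards_eq0 => /eqP F0 usP; exists us; split=> //.
  by rewrite -[LHS]setCK F0 setC0.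
move=> cF usP.
have [FT|] := eqVneq (fire p us (size us)) [set: H]; first by exists us.
rewrite -subTset => /subsetPn[v _ vF].
apply: (IH (rcons us v)).
  rewrite -ltnS; apply: leq_trans cF; apply: proper_card; rewrite properC.
  rewrite /fire !take_size foldl_rcons /=.
  apply/properP; split.
    by apply/subsetP => x xF; rewrite !inE xF orbT.
  by exists v; [rewrite setU11 | rewrite /fire take_size in vF].
move=> r u; rewrite onthE map_rcons nth_rcons size_map.
rewrite /fire -cats1 take_cat.
case: (ltnP r (size us)) => [rs|rs].
  by rewrite -onthE => /usP; rewrite /fire.
case: eqP => // -> [<-]; rewrite subnn take0 cats0.
by rewrite /fire take_size in vF.
Qed.

Lemma exists_lazy_burning_set (R : realType) (p : R) (H : hypergraph) :
  exists k : nat,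
    `[< exists S : {set H}, #|S| = k /\ lazy_burning_set p S >].
Proof.
exists #|[set: H]|; apply/asboolP; exists [set: H]; split=> // v.
by exists 0%N; rewrite inE.
Qed.

Definition burning_number (R : realType) (p : R) (H : hypergraph) : nat :=
  ex_minn (exists_burning_sequence p H).

Definition lazy_burning_number (R : realType) (p : R) (H : hypergraph) : nat :=
  ex_minn (exists_lazy_burning_set p H).

(* Main.v *)
(** An edge ignites once it has m burning vertices under p1, and m + 1 under
    p2. If an edge reaches the p2-threshold on F, it still reaches the
    p1-threshold on F minus any vertex u. Lazy game: some edge e reaches m +
    1 on a p2-burning set S, and S minus a vertex u of e relights u under
    p1. Burning game: let u be the source that first makes an edge reach m +
    1. If u is not the last source, deleting it costs nothing under p1:
    every edge it triggers, and hence u itself, already burns one round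
    earlier. Otherwise no propagation took place, so the sequence has at
    least n sources, whereas under p1 one can choose m vertices of an edge e
    and then the n - k > 0 vertices outside e. *)
Require Import Defs.
From mathcomp Require Import all_boot all_order all_algebra.
From mathcomp Require Import boolp reals.

Set Implicit Arguments.
Unset Strict Implicit.
Unset Printing Implicit Defensive.

Import Order.TTheory GRing.Theory Num.Theory.
Local Open Scope ring_scope.

Lemma ignitesE (R : realType) (p : R) (H : hypergraph) (F e : {set H}) :
  ignites p F e = (p * #|e|%:R <= #|e :&: F|%:R).
Proof. by rewrite /ignites ceil_le_int. Qed.

Lemma ignitesS (R : realType) (p : R) (H : hypergraph) (F G e : {set H}) :
  F \subset G -> ignites p F e -> ignites p G e.
Proof.
move=> FG; rewrite !ignitesE => /le_trans; apply.
by rewrite ler_nat subset_leq_card // setIS.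
Qed.

Lemma sub_propagate (R : realType) (p : R) (H : hypergraph) (F : {set H}) :
  F \subset propagate p F.
Proof. exact: subsetUl. Qed.

Lemma edge_sub_propagate (R : realType) (p : R) (H : hypergraph)
    (F e : {set H}) :
  e \in edges H -> ignites p F e -> e \subset propagate p F.
Proof.
move=> eH eF; apply: subsetU; apply/orP; right.
by apply: (bigcup_max e); rewrite ?eH ?subxx.
Qed.

Lemma propagate_sub (R : realType) (p : R) (H : hypergraph) (F G : {set H}) :
  F \subset G ->
  (forall e, e \in edges H -> ignites p F e -> e \subset G) ->
  propagate p F \subset G.
Proof.
move=> FG eG; rewrite subUset FG; apply/bigcupsP => e /andP[eH eF].
exact: eG.
Qed.

Lemma propagate_mono (R : realType) (p q : R) (H : hypergraph)
    (F G : {set H}) :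
  (forall e, e \in edges H -> ignites p F e -> ignites q G e) ->
  F \subset G -> propagate p F \subset propagate q G.
Proof.
move=> pq FG; apply: propagate_sub => [|e eH eF].
  exact: subset_trans FG (sub_propagate _ _).
exact/edge_sub_propagate/pq.
Qed.

Lemma propagate_id (R : realType) (p : R) (H : hypergraph) (F : {set H}) :
  {in edges H, forall e, ~~ ignites p F e} -> propagate p F = F.
Proof.
move=> q; apply/eqP; rewrite eqEsubset sub_propagate andbT.
by apply: propagate_sub => // e eH; rewrite (negbTE (q e eH)).
Qed.

Lemma lazy_burning_number_le (R : realType) (p : R) (H : hypergraph)
    (S : {set H}) :
  lazy_burning_set p S -> (lazy_burning_number p H <= #|S|)%N.
Proof.
move=> bS; rewrite /lazy_burning_number; case: ex_minnP => b _; apply.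
by apply/asboolP; exists S.
Qed.

Lemma lazy_burning_number_attained (R : realType) (p : R) (H : hypergraph) :
  exists2 S : {set H}, lazy_burning_set p S & #|S| = lazy_burning_number p H.
Proof.
rewrite /lazy_burning_number; case: ex_minnP => b /asboolP[S [<- bS]] _.
by exists S.
Qed.

(* The sources in [us] may already be burning, unlike in [burning_sequence]. *)
Definition burn (R : realType) (p : R) (H : hypergraph) (F : {set H})
    (us : seq H) : {set H} :=
  foldl (fun F u => u |: propagate p F) F us.

Lemma sub_burn (R : realType) (p : R) (H : hypergraph) (F : {set H})
    (us : seq H) :
  F :|: [set u in us] \subset burn p F us.
Proof.
elim: us F => [|u us IH] F; first by apply/subsetP => x; rewrite !inE orbF.
apply: subset_trans (IH _); apply/subsetP => x; rewrite !inE.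
by case/or3P => ->; rewrite ?orbT.
Qed.

Lemma burnS (R : realType) (p q : R) (H : hypergraph) (F G : {set H})
    (us : seq H) :
  (forall A e : {set H}, e \in edges H -> ignites p A e -> ignites q A e) ->
  F \subset G -> burn p F us \subset burn q G us.
Proof.
move=> pq; elim: us F G => [|u us IH] F G FG //=; apply/IH/setUS.
by apply: propagate_mono => // e eH /(ignitesS FG); apply: pq.
Qed.

(** Greedy repair: a source of [us] that already burns is replaced by any unburned vertex. The legal
    fire keeps containing the fire of [us], and the sequence stops early once every vertex burns. *)
Lemma burning_sequence_complete (R : realType) (p : R) (H : hypergraph)
    (A : {set H}) (us vs : seq H) :
  (forall r u, onth vs r = Some u -> u \notin fire p vs r) ->
  A \subset fire p vs (size vs) -> burn p A us = [set: H] ->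
  exists2 ws : seq H, burning_sequence p ws & (size ws <= size vs + size us)%N.
Proof.
elim: us A vs => [|u us IH] A vs vsP Avs /= usT.
  exists vs; last by rewrite addn0.
  by split=> //; apply/eqP; rewrite -subTset -usT.
have [vsT|] := eqVneq (fire p vs (size vs)) [set: H].
  by exists vs; [split | rewrite leq_addr].
rewrite -subTset => /subsetPn[x _ xF].
pose v := if u \in fire p vs (size vs) then x else u.
have vF : v \notin fire p vs (size vs).
  by rewrite /v; case: ifP => // ->.
have step : u |: propagate p A \subset v |: propagate p (fire p vs (size vs)).
  rewrite subUset sub1set !inE; apply/andP; split.
    by rewrite /v; case: ifP => _; rewrite ?eqxx ?orbT.
  apply: subset_trans (subsetUr _ _).
  by apply: propagate_mono => // e _; apply: ignitesS.
have fireE : fire p (rcons vs v) (size (rcons vs v)) =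
    v |: propagate p (fire p vs (size vs)).
  by rewrite /fire !take_size foldl_rcons.
have [||ws wsP wss] := IH (u |: propagate p A) (rcons vs v) _ _ usT.
- move=> r w; rewrite onthE map_rcons nth_rcons size_map /fire -cats1 take_cat.
  case: (ltnP r (size vs)) => [rs|rs]; first by rewrite -onthE => /vsP.
  by case: eqP => // -> [<-]; rewrite subnn take0 cats0
    -[vs in foldl _ _ vs]take_size.
- by rewrite fireE.
by exists ws => //; rewrite (leq_trans wss) // size_rcons addSnnS.
Qed.

(** Upper bounds may thus use sequences with redundant sources, such as one obtained by deleting a
    source. *)
Lemma burning_number_le (R : realType) (p : R) (H : hypergraph) (us : seq H) :
  burn p set0 us = [set: H] -> (burning_number p H <= size us)%N.
Proof.
move=> usT.
have [||ws wsP wss] := @burning_sequence_complete R p H set0 us [::] _ _ usT.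
- by case.
- exact: sub0set.
apply: leq_trans wss; rewrite /burning_number; case: ex_minnP => b _; apply.
by apply/asboolP; exists ws.
Qed.

Lemma burning_number_attained (R : realType) (p : R) (H : hypergraph) :
  exists2 us : seq H, burn p set0 us = [set: H] & size us = burning_number p H.
Proof.
rewrite /burning_number; case: ex_minnP => b /asboolP[us [<- [_ usT]]] _.
by exists us => //; rewrite -usT /fire take_size.
Qed.

(** While no edge ignites, propagation is idle and each round adds at most one vertex. The second
    alternative includes a further source [v], because an edge that [u] triggers spreads only in the
    next round. *)
Lemma first_ignition (R : realType) (p : R) (H : hypergraph) (F : {set H})
    (us : seq H) :
  {in edges H, forall e, ~~ ignites p F e} ->
  (#|burn p F us| <= #|F| + size us)%N \/
  exists s1 u v s2, [/\ us = s1 ++ [:: u, v & s2],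
    {in edges H, forall e, ~~ ignites p (burn p F s1) e} &
    exists2 e, e \in edges H & ignites p (u |: burn p F s1) e].
Proof.
elim: us F => [|u us IH] F qF; first by left; rewrite addn0.
rewrite /= (propagate_id qF).
have uFs : (#|u |: F| <= #|F|.+1)%N by rewrite cardsU1; case: (_ \notin _).
case: (pickP [pred e in edges H | ignites p (u |: F) e]).
  move=> e /andP[eH eF].
  (* If [u] is the last source, [e] gets no round in which to burn, so the count still holds. *)
  case: us {IH} => [|v us]; first by left; rewrite addn1.
  by right; exists [::], u, v, us; split=> //; exists e.
move=> qF1; have {}qF1 : {in edges H, forall e, ~~ ignites p (u |: F) e}.
  by move=> e eH; have /= := qF1 e; rewrite eH /= => ->.
case: (IH _ qF1) => [le|[s1 [w [v [s2 [-> q1 ex]]]]]].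
  by left; rewrite (leq_trans le) // addnS -addSn leq_add2r.
by right; exists (u :: s1), w, v, s2; split=> //=; rewrite (propagate_id qF).
Qed.

Lemma lazy_burning_number_lt (R : realType) (p1 p2 : R) (H : hypergraph)
    (e0 : {set H}) :
  e0 \in edges H -> ignites p2 [set: H] e0 ->
  {in edges H, forall e, ~~ ignites p2 set0 e} ->
  (forall (F e : {set H}) (u : H),
    e \in edges H -> ignites p2 F e -> ignites p1 (F :\ u) e) ->
  (lazy_burning_number p1 H < lazy_burning_number p2 H)%N.
Proof.
move=> e0H e0T q0 drop.
have [S bS <-] := lazy_burning_number_attained p2 H.
have [e eH eS] : exists2 e, e \in edges H & ignites p2 S e.
  case: (pickP [pred e in edges H | ignites p2 S e]) => [e /andP[]|qS].
    by exists e.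
  (* If no edge ignites from [S], then [S] is a fixed point of propagation, so it burns everything
     only if it is everything. *)
  suff ST : S = [set: H] by exists e0; rewrite ?ST.
  apply/eqP; rewrite -subTset; apply/subsetP => v _.
  have [r] := bS v; suff -> : iter r (@propagate R p2 H) S = S by [].
  elim: r => //= r ->; apply: propagate_id => e eH.
  by have /= := qS e; rewrite eH /= => ->.
have [u] : exists u, u \in e :&: S.
  apply/set0Pn; apply: contraNneq (q0 e eH) => eS0; move: eS.
  by rewrite /ignites setI0 eS0.
rewrite inE => /andP[ue uS].
have p1S : S \subset propagate p1 (S :\ u).
  apply/subsetP => x xS; have [->|xu] := eqVneq x u.
    by apply: (subsetP (edge_sub_propagate eH _)) => //; apply: drop.
  by apply: (subsetP (sub_propagate _ _)); rewrite !inE xu.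
rewrite (cardsD1 u S) uS add1n ltnS; apply: lazy_burning_number_le => v.
(* The extra round is the one that relights [u]; from then on the [p1] fire contains the [p2] fire
   round by round. *)
have [r vr] := bS v; exists r.+1; rewrite iterSr.
apply: subsetP vr; elim: r => [|r IH] //=; apply: propagate_mono => // f fH fF.
by apply: ignitesS (drop _ _ u fH fF); apply: subset_trans (subD1set _ _) IH.
Qed.

(* [e0 != [set: H]] cannot be dropped: when [e0] burns by propagation, a source
   outside [e0] has to be available for the same round. *)
Lemma burning_number_lt (R : realType) (p1 p2 : R) (H : hypergraph)
    (e0 S0 : {set H}) :
  e0 \in edges H -> e0 != [set: H] -> S0 \proper e0 -> ignites p1 S0 e0 ->
  {in edges H, forall e, ~~ ignites p2 set0 e} ->
  (forall (F e : {set H}) (u : H),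
    e \in edges H -> ignites p2 F e -> ignites p1 (F :\ u) e) ->
  (burning_number p1 H < burning_number p2 H)%N.
Proof.
move=> e0H e0T S0e0 e0S0 q0 drop.
have p12 (F e : {set H}) : e \in edges H -> ignites p2 F e -> ignites p1 F e.
  move=> eH eF; have /card_gt0P[u _] := vertex_gt0 H.
  exact: ignitesS (subD1set F u) (drop _ _ u eH eF).
have [us usT <-] := burning_number_attained p2 H.
case: (first_ignition us q0) => [|[s1 [u [v [s2 [us_def q1 [e eH eF]]]]]]].
  rewrite usT cards0 add0n cardsT => Hus.
  have le : (burning_number p1 H <= size (enum S0 ++ enum (~: e0)))%N.
    apply: burning_number_le; apply/eqP; rewrite -subTset /burn foldl_cat.
    have S0F := sub_burn p1 set0 (enum S0); rewrite set0U set_enum in S0F.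
    (* Once [S0] burns, the round of one more source [x] burns all of [e0]; hence the nonempty
       list. *)
    have subF x s : [set y in x :: s] :|: e0 \subset
        burn p1 (burn p1 set0 (enum S0)) (x :: s).
      rewrite subUset; have := sub_burn p1 (burn p1 set0 (enum S0)) (x :: s).
      rewrite subUset => /andP[_ ->].
      apply: subset_trans (sub_burn _ (x |: propagate p1 _) s); rewrite -setUA.
      apply/subsetU/orP; right; apply/subsetU/orP; left.
      exact: edge_sub_propagate e0H (ignitesS S0F e0S0).
    case xs_def: (enum (~: e0)) => [|x s].
      case/eqP: e0T; rewrite -[e0]setCK -(set_enum (~: e0)) xs_def.
      by apply/setP => z; rewrite !inE.
    by apply: subset_trans (subF x s); rewrite -xs_def set_enum setUC setUCr.
  apply: leq_ltn_trans le (leq_trans _ Hus); rewrite size_cat -!cardE.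
  by rewrite -(cardsC e0) ltn_add2r proper_card.
apply: (@leq_ltn_trans (size (s1 ++ v :: s2))); last first.
  by rewrite us_def !size_cat ltn_add2l.
apply: burning_number_le; apply/eqP.
rewrite -subTset -usT us_def /burn !foldl_cat /=.
set F := foldl _ _ s1; rewrite -/(burn p2 set0 s1) in F *.
(* The fires with and without [u] are compared right after [v]: it suffices that
   [propagate p2 (u |: F)] lies in [propagate p1 G]. *)
rewrite (propagate_id q1); apply: burnS => //; apply: setUS.
set G := foldl _ _ s1.
have FG : F \subset G by apply: burnS.
have early f : f \in edges H -> ignites p2 (u |: F) f -> ignites p1 G f.
  move=> fH /(drop _ _ u fH); apply: ignitesS; apply: subset_trans FG.
  by apply/subsetP => x; rewrite !inE => /andP[/negbTE->].
(* Since [e] ignites from [u |: F] but not from [F], it contains [u]; burning [e] therefore recovers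
   the deleted source. *)
have ue : u \in e.
  apply: contraNT (q1 e eH) => ue; move: eF; rewrite !ignitesE.
  suff -> : e :&: (u |: F) = e :&: F by [].
  apply/setP => x; rewrite !inE; have [->|//] := eqVneq x u.
  by rewrite (negbTE ue).
apply: propagate_sub => [|f fH fF]; last first.
  exact: edge_sub_propagate (early f fH fF).
rewrite subUset sub1set (subset_trans FG (sub_propagate _ _)) andbT.
exact: (subsetP (edge_sub_propagate eH (early e eH eF))).
Qed.

Theorem theorem3p7 (R : realType) (H : hypergraph) (k n m : nat) (p1 p2 : R)
    (unif_H : uniform k H)
    (card_H : #|H| = n)
    (multiple_edges : (1 < #|edges H|)%N)
    (m_range : (1 <= m <= k - 1)%N)
    (p1_def : p1 = m%:R / k%:R)
    (p2_range : m%:R / k%:R < p2 < m.+1%:R / k%:R) :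
  (lazy_burning_number p1 H < lazy_burning_number p2 H)%N /\
  (burning_number p1 H < burning_number p2 H)%N.
Proof.
case/andP: m_range => m_gt0 m_le.
(* The subtraction in [k - 1] is truncated; [1 <= m] rules out [k = 0]. *)
have mk : (m < k)%N.
  have := leq_trans m_gt0 m_le; rewrite subn_gt0 => /ltnW k_gt0.
  by rewrite -(subnK k_gt0) addn1 ltnS.
have k_gt0 : 0 < k%:R :> R by rewrite ltr0n (leq_trans _ mk).
have ign1 (F e : {set H}) : e \in edges H ->
    ignites p1 F e = (m <= #|e :&: F|)%N.
  move=> eH; rewrite ignitesE p1_def (unif_H e eH) divfK ?ler_nat //.
  by rewrite gt_eqF.
(* As [p2 * k] lies strictly between [m] and [m + 1], an integer reaches it exactly when it exceeds
   [m]. *)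
have ign2 (F e : {set H}) : e \in edges H ->
    ignites p2 F e = (m < #|e :&: F|)%N.
  move=> eH; rewrite ignitesE (unif_H e eH).
  move: p2_range; rewrite ltr_pdivrMr // ltr_pdivlMr // => /andP[lo hi].
  apply/idP/idP => [/(lt_le_trans lo)|]; first by rewrite ltr_nat.
  by rewrite -(ler_nat R); apply: le_trans (ltW hi).
have q0 : {in edges H, forall e, ~~ ignites p2 set0 e}.
  by move=> e eH; rewrite ign2 // setI0 cards0.
have drop (F e : {set H}) (u : H) :
    e \in edges H -> ignites p2 F e -> ignites p1 (F :\ u) e.
  move=> eH; rewrite ign1 // ign2 // setIDA (cardsD1 u (e :&: F)).
  by case: (u \in _) => // /ltnW.
have [e0 [e1 [e0H e1H e01]]] := card_gt1P multiple_edges.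
(* If [e0] were everything, [e1] would be a subset of the same size, hence equal to it. *)
have e0T : e0 != [set: H].
  apply: contraNneq e01 => e0T; rewrite eq_sym eqEcard e0T subsetT -e0T.
  by rewrite (unif_H _ e0H) (unif_H _ e1H) leqnn.
split.
  apply: (lazy_burning_number_lt e0H) => //.
  by rewrite ign2 // setIT (unif_H _ e0H).
have [S0 S0e0 S0m] : exists2 S0 : {set H}, S0 \subset e0 & #|S0| = m.
  exists [set x in take m (enum e0)].
    by apply/subsetP => x; rewrite inE => /mem_take; rewrite mem_enum.
  rewrite cardsE (card_uniqP (take_uniq _ (enum_uniq _))) size_takel //.
  by rewrite -cardE (unif_H _ e0H) ltnW.
apply: (@burning_number_lt _ _ _ _ e0 S0) => //.
  by rewrite properEcard S0e0 S0m (unif_H _ e0H).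
by rewrite ign1 // (setIidPr S0e0) S0m.
Qed.
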